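(* Let $k \geq 2$ be a fixed integer. Then, as $n \to \infty$, \[ \mathrm{ex^*}(n,B_{k,2}) = \begin{cases}\frac{k}{2}n + O(1) & \text{ if } k \text{ is odd}, \\ \frac{k-1}{2}n + O(1) & \text{ if } k \in\{2,4\},\\ \frac{k^2}{2(k+1)}n + O(1) & \text{ if } k \text{ is even and } k \geq 6, \end{cases} \] where $O(1)$ denotes a quantity bounded in absolute value by a constant depending only on $k$.
   Context: All graphs are finite and simple. An edge-coloring of a graph $G$ is a function $c: E(G) \to \mathbb{N}$; it is proper if no two edges sharing a vertex receive the same color. A subgraph is rainbow under $c$ if all its edges receive distinct colors. For a fixed graph $F$, a graph $G$ is rainbow-$F$-free under $c$ if $G$ contains no subgraph isomorphic to $F$ that is rainbow under $c$. The rainbow Turán number $\mathrm{ex^*}(n,F)$ is the maximum number of edges in an $n$-vertex graph $G$ that admits a proper edge-coloring under which $G$ is rainbow-$F$-free. For $k \geq 2$, the broom $B_{k,2}$ is the tree with $k$ edges obtained from a path $xyz$ with two edges (the handle) by attaching $k-2$ pendant edges (bristles) to the endpoint $z$; equivalently, it has a vertex $z$ of degree $k-1$, one of whose neighbors $y$ has one further neighbor $x$, and all other vertices are leaves adjacent to $z$. *)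

(* Defs.v *)
From mathcomp Require Import all_boot all_order all_algebra.
From mathcomp Require Import boolp.

Set Implicit Arguments.
Unset Strict Implicit.
Unset Printing Implicit Defensive.

(* A finite simple graph with vertex type V is given by its edge set
   E : {set {set V}}, all of whose members must be unordered pairs. *)
Definition simple_graph (V : finType) (E : {set {set V}}) : bool :=
  [forall e in E, #|e| == 2].

(* Edge-colorings of E are functions c : {set V} -> nat; only the values of c
   on E are ever used. *)
Definition proper_coloring (V : finType) (E : {set {set V}})
    (c : {set V} -> nat) : Prop :=
  forall e f, e \in E -> f \in E -> e != f -> e :&: f != set0 -> c e <> c f.

Definition rainbow (V : finType) (D : {set {set V}}) (c : {set V} -> nat) : Prop :=
  {in D &, injective c}.

Definition subgraph (V : finType) (W : {set V}) (D E : {set {set V}}) : Prop :=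
  D \subset E /\ forall e, e \in D -> e \subset W.

(* The graph (U, F) is isomorphic to the graph with vertex set W and edge
   set D. *)
Definition graph_iso (U V : finType) (F : {set {set U}})
    (W : {set V}) (D : {set {set V}}) : Prop :=
  exists f : U -> V,
    [/\ injective f, W = [set f u | u in [set: U]]
      & D = [set f @: e | e : {set U} in F]].

Definition rainbow_free (U V : finType) (F : {set {set U}})
    (E : {set {set V}}) (c : {set V} -> nat) : Prop :=
  ~ exists (W : {set V}) (D : {set {set V}}),
      [/\ subgraph W D E, graph_iso F W D & rainbow D c].

Definition rainbow_ex (n : nat) (U : finType) (F : {set {set U}}) : nat :=
  \max_(E : {set {set 'I_n}} | simple_graph E &&
      `[< exists c, proper_coloring E c /\ rainbow_free F E c >]) #|E|.

(* The broom B_{k,2} (for k >= 2) on the vertices 0, ..., k: z is 0, its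
   neighbours are 1, ..., k-1, y is 1, and x is k. *)
Definition broom (k : nat) : {set {set 'I_k.+1}} :=
  [set e | [exists i : 'I_k.+1, exists j : 'I_k.+1,
     (e == [set i; j]) &&
     (((i == 0 :> nat) && (0 < j < k)) || ((i == 1 :> nat) && (j == k :> nat)))]].

(* Main.v *)
(** Lower bounds: take disjoint copies of a graph on k + 1 vertices, properly
    colored with k colors, in which no vertex has degree k - 1. The center of a
    broom in it has degree k, so it sees all the colors, and the broom is not
    rainbow. For k odd, a 1-factorized complete graph will do. For k = 2m >= 6 we
    remove from the complete graph the m edges of a graph M without vertices of
    degree 1, so that each of the k colors can cover all the vertices but one.
    Here M is K_(2,r), or K_(2,r) plus an edge in its part of size 2; the
    coloring is given on the vertices of M and extended by one vertex at a time,
    the colors of the new edges being provided by Hall's theorem. For k = 2 and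
    k = 4, copies of the complete graph on k vertices are optimal.

    Upper bounds: the component of a vertex of degree larger than k is a star.
    The component of a vertex v of degree k is its closed neighborhood, and only
    the k colors seen by v occur in it; if k is even, each of them misses a
    vertex, so the component has at most k^2 / 2 edges. If this bound is
    attained, each color misses exactly one vertex, which excludes vertices of
    degree k - 1: such a vertex and its non-neighbor miss the same color. A
    non-neighbor of a deficient vertex being deficient as well, this takes
    k >= 6. *)

Require Import Defs.
From mathcomp Require Import all_boot all_order all_algebra.
From mathcomp Require Import zify lra.

Set Implicit Arguments.
Unset Strict Implicit.
Unset Printing Implicit Defensive.

(** * Hall's theorem *)

(** Induction on [#|A|]. If a nonempty proper subset [S] is tight, match it inside its neighborhood
    and the rest outside; otherwise proper subsets have a surplus, and any admissible pair [a], [b]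
    can be matched first. *)
Lemma Hall_matching (X Y : finType) (y0 : Y) (N : X -> {set Y}) (A : {set X}) :
  (forall S : {set X}, S \subset A -> #|S| <= #|\bigcup_(x in S) N x|) ->
  exists f : X -> Y, {in A, forall x, f x \in N x} /\ {in A &, injective f}.
Proof.
have [n] := ubnP #|A|; elim: n => // n IH in A N *; rewrite ltnS => leA hall.
case: (set_0Vmem A) => [->|[a aA]].
  by exists (fun=> y0); split=> [x|x y]; rewrite inE.
case: (pickP (fun S : {set X} =>
   [&& S != set0, S \proper A & #|S| == #|\bigcup_(x in S) N x|])) => [S|noS].
  case/and3P=> S0 SA /eqP; set NS := \bigcup_(x in S) N x => cS.
  have sSA := proper_sub SA.
  have [|T TS|f [fN fI]] := IH S N.
  - exact: leq_trans (proper_card SA) leA.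
  - by apply: hall; apply: subset_trans sSA.
  have [|T TS|g [gN gI]] := IH (A :\: S) (fun x => N x :\: NS).
  - have := cardsID S A; rewrite (setIidPr sSA).
    by move: leA; rewrite -card_gt0 in S0; lia.
  (* Hall's condition for [T :|: S], minus the equality for [S], is what [T] needs outside [NS]. *)
  - have dTS : T :&: S = set0.
      by apply/eqP; rewrite setI_eq0; move: TS; rewrite subsetD => /andP[].
    have := hall (T :|: S); rewrite subUset sSA (subset_trans TS (subsetDl _ _)).
    move=> /(_ isT); rewrite cardsU dTS cards0 subn0 bigcup_setU -/NS => le1.
    have le2 : #|\bigcup_(x in T) N x :|: NS| <=
               #|\bigcup_(x in T) (N x :\: NS)| + #|NS|.
      apply: leq_trans (leq_card_setU _ _); apply: subset_leq_card.
      apply/subsetP=> y; rewrite !inE => /orP[/bigcupP[x xT yx]|->]; last by rewrite orbT.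
      case: (boolP (y \in NS)) => yS; first by rewrite orbT.
      by rewrite orbF; apply/bigcupP; exists x => //; rewrite inE yS.
    by lia.
  exists (fun x => if x \in S then f x else g x); split=> [x xA|x y xA yA].
    case: ifP => xS; first exact: fN.
    by have := gN x; rewrite !inE xS xA => /(_ isT) /andP[].
  have fNS z : z \in S -> f z \in NS by move=> zS; apply/bigcupP; exists z => //; apply: fN.
  have gNS z : z \in A -> z \notin S -> g z \notin NS.
    by move=> zA zS; have := gN z; rewrite !inE zS zA => /(_ isT) /andP[].
  case: ifPn => xS; case: ifPn => yS E.
  - exact: fI.
  - by have := gNS _ yA yS; rewrite -E fNS.
  - by have := gNS _ xA xS; rewrite E fNS.
  - by apply: gI => //; rewrite inE ?xA ?yA ?xS ?yS.
have : 0 < #|N a|.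
  have := hall [set a]; rewrite sub1set aA cards1 big_set1; exact.
case/card_gt0P=> b ba.
have [|S SA|f [fN fI]] := IH (A :\ a) (fun x => N x :\ b).
- by move: leA; rewrite (cardsD1 a) aA.
- case: (eqVneq S set0) => [->|S0]; first by rewrite cards0.
  have pSA : S \proper A.
    by apply: sub_proper_trans SA _; rewrite properD1.
  have lt1 : #|S| < #|\bigcup_(x in S) N x|.
    by rewrite ltn_neqAle hall ?proper_sub // andbT; have := noS S; rewrite S0 pSA /= => ->.
  have le2 : #|\bigcup_(x in S) N x| <= #|\bigcup_(x in S) (N x :\ b)| + #|[set b]|.
    apply: leq_trans (leq_card_setU _ _); apply: subset_leq_card.
    apply/subsetP=> y /bigcupP[x xS yx]; rewrite !inE.
    case: (eqVneq y b) => yb; first by rewrite orbT.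
    by rewrite orbF; apply/bigcupP; exists x => //; rewrite !inE yb.
  by move: le2; rewrite cards1; lia.
exists (fun x => if x == a then b else f x); split=> [x xA|x y xA yA].
  case: eqP => [->|/eqP xa] //.
  by have := fN x; rewrite !inE xa xA => /(_ isT) /andP[].
have fb z : z \in A -> z != a -> f z != b.
  by move=> zA za; have := fN z; rewrite !inE za zA => /(_ isT) /andP[].
case: (eqVneq x a) => [->|xa]; case: (eqVneq y a) => [-> //|ya] E.
- by have := fb _ yA ya; rewrite -E eqxx.
- by have := fb _ xA xa; rewrite E eqxx.
- by apply: fI => //; rewrite !inE ?xa ?ya.
Qed.

(* Double counting the total weight on the rows [S] gives Hall's condition. *)
Lemma weighted_matching (X Y : finType) (w : X -> Y -> nat) (r : nat) (y0 : Y) :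
  0 < r -> (forall x, \sum_y w x y = r) -> (forall y, \sum_x w x y <= r) ->
  exists f : X -> Y, injective f /\ forall x, 0 < w x (f x).
Proof.
move=> r0 rows cols.
have [S _|f [fN fI]] := @Hall_matching X Y y0 (fun x => [set y | 0 < w x y]) setT.
  set NS := \bigcup_(x in S) _.
  suff : #|S| * r <= #|NS| * r by rewrite leq_pmul2r.
  have -> : #|S| * r = \sum_(x in S) \sum_y w x y.
    by rewrite (eq_bigr (fun=> r)) ?sum_nat_const // => x _; apply: rows.
  rewrite -sum_nat_const exchange_big /= [X in _ <= X]big_mkcond /=.
  apply: leq_sum => y _; case: ifPn => yN.
    apply: leq_trans (cols y); rewrite [X in _ <= X](bigID (mem S)) /=; exact: leq_addr.
  rewrite leqn0 sum_nat_eq0; apply/forall_inP => x xS; rewrite -leqn0 leqNgt.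
  by apply: contra yN => wxy; apply/bigcupP; exists x => //; rewrite inE.
exists f; split=> [x y|x]; first by apply: fI.
by have := fN x; rewrite !inE; apply.
Qed.

(** * Completing partial factorizations *)

Lemma sum_pred_card (T : finType) (P : pred T) :
  \sum_x (P x : nat) = #|[set x | P x]|.
Proof.
by rewrite -sum1dep_card [RHS]big_mkcond; apply: eq_bigr => x _; case: (P x).
Qed.

Lemma card_sep_sum (T : finType) (A : {set T}) (P : pred T) :
  #|[set x in A | P x]| = \sum_(x in A) P x.
Proof.
by rewrite -sum1dep_card big_mkcondr; apply: eq_bigr => x _; case: (P x).
Qed.

Lemma card_set_option (T : finType) (P : pred (option T)) :
  #|[set u | P u]| = P None + #|[set x | P (Some x)]|.
Proof.
rewrite -!sum_pred_card (bigD1 None) //=; congr (_ + _).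
rewrite (reindex_omap Some id) /=; last by case.
by apply: eq_bigl => x; rewrite eqxx.
Qed.

Section PartialFactorization.
Variables (C T : finType) (adj : rel T) (col : T -> T -> C) (mu : C -> option T).

Definition sees (x : T) (c : C) : bool := [exists y, adj x y && (col x y == c)].

Definition lacks (x : T) (c : C) : bool := (mu c != Some x) && ~~ sees x c.

(* A properly colored graph to be completed, one vertex at a time, to a graph
   on #|C| + 1 vertices in which every color class covers every vertex, except
   that the vertex [mu c] (if any) never sees [c]. New vertices are joined to
   all the others, so the number of non-neighbors of [x] has to be the number
   of colors reserved by [mu] for [x]. The [exists] in the last clause says that
   the number of vertices still lacking [c] is at most the number of vertices
   to be added, and has the same parity. *)
Record partial_factorization : Prop := PartialFactorization {
  pf_sym : symmetric adj;
  pf_irr : irreflexive adj;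
  pf_colC : forall x y, col x y = col y x;
  pf_proper : forall x y z, adj x y -> adj x z -> col x y = col x z -> y = z;
  pf_mu : forall x y, adj x y -> mu (col x y) != Some x;
  pf_deg : forall x, (#|adj x| + #|[set c | mu c == Some x]|).+1 = #|T|;
  pf_lack : forall c, exists j,
    #|[set x | lacks x c]| + #|T| + j.*2 = #|C|.+1
}.

Hypothesis pf : partial_factorization.

Lemma card_sees x : #|[set c | sees x c]| = #|adj x|.
Proof.
have -> : [set c | sees x c] = [set col x y | y in adj x].
  apply/setP=> c; rewrite inE; apply/existsP/imsetP => [[y /andP[xy /eqP<-]]|[y xy ->]].
    by exists y.
  by exists y; rewrite eqxx andbT.
by rewrite card_in_imset // => y z; apply: (pf_proper pf).
Qed.

(** The colors seen by [x], reserved for [x] and lacking at [x] partition [C]; so [x] lacks as many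
    colors as there are vertices left to add. *)
Lemma card_lacks_row x : #|[set c | lacks x c]| + #|T| = #|C|.+1.
Proof.
rewrite -(pf_deg pf x) -card_sees -cardsUI.
have -> : [set c | sees x c] :&: [set c | mu c == Some x] = set0.
  apply/setP=> c; rewrite !inE; apply/negP=> /andP[/existsP[y /andP[xy /eqP<-]]].
  by rewrite (negbTE (pf_mu pf xy)).
rewrite cards0 addn0 addnS -(cardsC [set c | lacks x c]); congr (_ + _).+1.
by apply: eq_card => c; rewrite !inE /lacks negb_and !negbK orbC.
Qed.

Definition adj_ext : rel (option T) := fun u v =>
  match u, v with
  | Some x, Some y => adj x y
  | None, None => false
  | _, _ => true
  end.

Definition col_ext (c0 : C) (g : T -> C) (u v : option T) : C :=
  match u, v with
  | Some x, Some y => col x y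
  | Some x, None | None, Some x => g x
  | None, None => c0
  end.

Definition mu_ext (c : C) : option (option T) := omap Some (mu c).

Lemma mu_ext_Some c x : (mu_ext c == Some (Some x)) = (mu c == Some x).
Proof. by rewrite /mu_ext; case: (mu c). Qed.

Lemma mu_ext_None c : (mu_ext c == Some None) = false.
Proof. by rewrite /mu_ext; case: (mu c). Qed.

(* The matching of vertices with the lacking colors has to use every color that
   is lacked by as many vertices as remain to be added; padding the vertices
   with dummies that compete for the other colors enforces this. *)
Lemma lacking_matching (c0 : C) : #|T| <= #|C| ->
  exists g : T -> C, [/\ injective g, forall x, lacks x (g x)
    & forall c, c \notin codom g -> #|[set x | lacks x c]| + #|T| <= #|C|].
Proof.
move=> leTC; pose D := #|C|.+1 - #|T|.
have D0 : 0 < D by rewrite /D; lia.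
(* [K] makes the rows of the vertices and of the [D.-1] dummies all sum to [K * D]; the maximum with
   1 keeps vertex weights positive when [D = 1] and there are no dummies. *)
pose K := maxn D.-1 1.
pose f c := #|[set x | lacks x c]|.
have fD c : f c <= D by have [j] := pf_lack pf c; rewrite /f /D; lia.
have sumlx x : \sum_c (lacks x c : nat) = D.
  by rewrite sum_pred_card /D -(card_lacks_row x) addnK.
have sumlc c : \sum_x (lacks x c : nat) = f c by rewrite sum_pred_card.
pose w (u : T + 'I_D.-1) c : nat :=
  match u with inl x => K * lacks x c | inr _ => D - f c end.
have [|u|c|h [hI hw]] := @weighted_matching _ _ w (K * D) c0.
- by rewrite muln_gt0 D0 andbT /K; lia.
- case: u => [x|i] /=; first by rewrite -big_distrr /= sumlx.
  have -> : K = D.-1 by have := ltn_ord i; rewrite /K; lia.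
  have : \sum_c (D - f c) + \sum_c f c = #|C| * D.
    rewrite -big_split /= -sum_nat_const; apply: eq_bigr => c _.
    exact: subnK.
  have -> : \sum_c f c = #|T| * D.
    rewrite -sum_nat_const -(eq_bigr _ (fun x _ => sumlx x)) exchange_big /=.
    by apply: eq_bigr => c _; rewrite sumlc.
  move=> E; have -> : D.-1 = #|C| - #|T| by rewrite /D; lia.
  by rewrite mulnBl -E addnK.
- rewrite big_sumType /= -big_distrr /= sumlc sum_nat_const card_ord.
  have /leq_mul /(_ (leqnn (D - f c))) : D.-1 <= K by rewrite /K; lia.
  by rewrite -[X in _ -> _ <= K * X](subnKC (fD c)) mulnDr leq_add2l.
have cX : #|{: T + 'I_D.-1}| = #|C| by rewrite card_sum card_ord /D; lia.
exists (fun x => h (inl x)); split=> [x y /hI[]//|x|c cg].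
  by have := hw (inl x); rewrite /= muln_gt0 lt0b => /andP[].
have /codomP[[x|i] ci] : c \in codom h.
  by apply: inj_card_onto => //; rewrite cX.
- by case/negP: cg; rewrite ci; apply: (codom_f (fun x => h (inl x))).
- have : 0 < D - f c by rewrite ci; apply: (hw (inr i)).
  rewrite subn_gt0 /f /D.
  by lia.
Qed.

End PartialFactorization.

Lemma partial_factorization_step (C T : finType) (adj : rel T)
    (col : T -> T -> C) (mu : C -> option T) (c0 : C) :
  partial_factorization adj col mu -> #|T| <= #|C| ->
  exists col' : option T -> option T -> C,
    partial_factorization (adj_ext adj) col' (mu_ext mu).
Proof.
move=> pf leTC; have [g [gI gl gc]] := lacking_matching pf c0 leTC.
exists (col_ext col c0 g).
have gsees x y : adj x y -> g x <> col x y.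
  move=> xy E; have /andP[_ /existsP[]] := gl x.
  by exists y; rewrite xy E eqxx.
have seesS x c : sees (adj_ext adj) (col_ext col c0 g) (Some x) c =
                 sees adj col x c || (g x == c).
  apply/existsP/orP => [[[y|] /= H]|[/existsP[y H]|H]].
  - by left; apply/existsP; exists y.
  - by right.
  - by exists (Some y).
  - by exists None.
have seesN c : sees (adj_ext adj) (col_ext col c0 g) None c = (c \in codom g).
  apply/existsP/codomP => [[[y|] //= /eqP<-]|[y ->]]; first by exists y.
  by exists (Some y); rewrite /= eqxx.
split.
- by case=> [x|] [y|] //=; apply: (pf_sym pf).
- by case=> [x|] //=; apply: (pf_irr pf).
- by case=> [x|] [y|] //=; apply: (pf_colC pf).
- case=> [x|] [y|] [z|] //= xy xz E.
  + by congr Some; apply: (pf_proper pf) E.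
  + by case: (gsees _ _ xy); rewrite E.
  + by case: (gsees _ _ xz); rewrite E.
  + by rewrite (gI _ _ E).
- case=> [x|] [y|] //= xy; rewrite ?mu_ext_Some ?mu_ext_None //.
  + exact: (pf_mu pf).
  + by have /andP[] := gl x.
- have cE (U : finType) (e : rel U) u : #|e u| = #|[set v | e u v]|.
    by rewrite cardsE.
  case=> [x|]; rewrite card_option cE card_set_option /=.
  + rewrite add1n -cE -(pf_deg pf x) addSn; congr (_ + _).+2.
    by apply: eq_card => c; rewrite !inE mu_ext_Some.
  + rewrite add0n cardsT [X in _ + X]eq_card0 ?addn0 // => c.
    by rewrite !inE mu_ext_None.
- move=> c; rewrite card_option card_set_option.
  have [j Ej] := pf_lack pf c.
  rewrite {1}/lacks seesN mu_ext_None /=.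
  set L := [set x | lacks _ _ _ (Some x) c].
  set L0 := [set x | lacks adj col mu x c] in Ej.
  have LE : L = L0 :\: [set x | g x == c].
    apply/setP=> x; rewrite !inE /lacks seesS mu_ext_Some negb_or.
    by rewrite andbA andbC.
  (* If the new vertex sees [c], one vertex stops lacking [c] while the vertex count grows by one,
     and [j] is kept. Otherwise the new vertex lacks [c] too, and [j] drops by one; the choice of
     [g] makes it positive. *)
  case: (boolP (c \in codom g)) => cg /=.
    case/codomP: cg => x cx; exists j.
    have -> : L = L0 :\ x.
      by rewrite LE; congr (_ :\: _); apply/setP=> y; rewrite !inE cx (inj_eq gI).
    by move: Ej; rewrite (cardsD1 x) inE cx gl add0n addnS.
  exists j.-1; have := gc _ cg; rewrite -/L0 => le1.
  have -> : L = L0.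
    rewrite LE; apply/setDidPl; rewrite disjoint_subset; apply/subsetP=> x _.
    by rewrite !inE; apply: contra cg => /eqP<-; apply: codom_f.
  move: Ej le1; rewrite add1n addnS !addSn; move: (#|L0| + #|T|) #|C| => a b.
  by lia.
Qed.

(** The condition on [mu] says that no vertex will have degree [#|C|.-1] in the finished graph; it
    survives because added vertices have no reserved color. *)
Lemma partial_factorization_complete (C T : finType) (adj : rel T)
    (col : T -> T -> C) (mu : C -> option T) (c0 : C) :
  partial_factorization adj col mu ->
  (forall x, #|[set c | mu c == Some x]| != 1) ->
  exists (T' : finType) (adj' : rel T') (col' : T' -> T' -> C) mu',
    [/\ partial_factorization adj' col' mu', #|T'| = #|C|.+1,
        forall x, #|[set c | mu' c == Some x]| != 1
      & forall c, (mu' c == None) = (mu c == None)].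
Proof.
move=> pf mu1.
have leT : #|T| <= #|C|.+1 by have [j] := pf_lack pf c0; lia.
move En : (#|C|.+1 - #|T|) => n; elim: n => [|n IH] in T adj col mu pf mu1 leT En *.
  by exists T, adj, col, mu; split=> //; lia.
have [|col' pf'] := partial_factorization_step c0 pf; first by lia.
have [|||T' [adj' [col'' [mu' [H1 H2 H3 H4]]]]] := IH _ _ _ _ pf'.
- case=> [x|].
    rewrite (_ : [set c | _] = [set c | mu c == Some x]) //.
    by apply/setP=> c; rewrite !inE mu_ext_Some.
  rewrite (_ : [set c | _] = set0) ?cards0 //.
  by apply/setP=> c; rewrite !inE mu_ext_None.
- by rewrite card_option; lia.
- by rewrite card_option; lia.
exists T', adj', col'', mu'; split=> // c; rewrite H4 /mu_ext.
by case: (mu c).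
Qed.

(** * Graphs given by a relation *)

Definition neighbors (V : finType) (E : {set {set V}}) (x : V) : {set V} :=
  [set y | [set x; y] \in E].

Definition edges_of_rel (V : finType) (adj : rel V) : {set {set V}} :=
  [set [set p.1; p.2] | p in [pred p : V * V | adj p.1 p.2]].

Lemma set2_eq (V : finType) (a b x y : V) : a != b -> [set x; y] = [set a; b] ->
  x = a /\ y = b \/ x = b /\ y = a.
Proof.
move=> ab E; have ha : a \in [set x; y] by rewrite E set21.
have hb : b \in [set x; y] by rewrite E set22.
move: ha hb; rewrite !inE => /orP[]/eqP aE /orP[]/eqP bE; subst.
- by rewrite eqxx in ab.
- by left.
- by right.
- by rewrite eqxx in ab.
Qed.

Section SimpleGraph.
Variables (V : finType) (E : {set {set V}}).
Hypothesis simpleE : simple_graph E.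

Lemma edge_neq x y : [set x; y] \in E -> x != y.
Proof. by move/(forall_inP simpleE); rewrite cards2; case: (x != y). Qed.

Lemma edgeP e : e \in E -> exists x y, x != y /\ e = [set x; y].
Proof. by move=> eE; apply/cards2P/(forall_inP simpleE). Qed.

Lemma card_neighbors x : #|neighbors E x| = #|[set e in E | x \in e]|.
Proof.
rewrite -(card_in_imset (f := fun y => [set x; y]) (D := mem (neighbors E x))); last first.
  move=> y z; rewrite !inE => /edge_neq xy /edge_neq xz /(set2_eq xz) [[_ ->]//|[xz' _]].
  by rewrite xz' eqxx in xz.
apply: eq_card => e; rewrite inE; apply/imsetP/andP => [[y yx ->]|[eE xe]].
  by rewrite inE in yx; rewrite yx set21.
have [a [b [ab eab]]] := edgeP eE; move: xe eE; rewrite eab !inE.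
case/orP=> /eqP->; first by exists b; rewrite ?inE.
by exists a; rewrite ?inE setUC.
Qed.

Lemma handshake : \sum_x #|neighbors E x| = #|E| * 2.
Proof.
have -> : \sum_x #|neighbors E x| = \sum_x \sum_(e in E) (x \in e : nat).
  apply: eq_bigr => x _; rewrite card_neighbors -sum1dep_card big_mkcondr /=.
  by apply: eq_bigr => e _; case: (x \in e).
rewrite exchange_big -sum_nat_const; apply: eq_bigr => e eE.
by rewrite (sum_pred_card (mem e)) cardsE; apply/eqP/(forall_inP simpleE).
Qed.
End SimpleGraph.

Section GraphOfRelation.
Variables (V : finType) (adj : rel V).
Hypotheses (adj_sym : symmetric adj) (adj_irr : irreflexive adj).

Lemma adj_neq x y : adj x y -> x != y.
Proof. by apply: contraTneq => ->; rewrite adj_irr. Qed.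

Lemma edges_of_relE x y : ([set x; y] \in edges_of_rel adj) = adj x y.
Proof.
apply/imsetP/idP => [[[a b] /= ab]|xy]; last by exists (x, y).
by case/(set2_eq (adj_neq ab)) => -[-> ->] //; rewrite adj_sym.
Qed.

Lemma simple_edges_of_rel : simple_graph (edges_of_rel adj).
Proof.
by apply/forall_inP => e /imsetP[[a b] /= ab ->]; rewrite cards2 (adj_neq ab).
Qed.

Lemma card_edges_of_rel : \sum_x #|adj x| = #|edges_of_rel adj| * 2.
Proof.
rewrite -(handshake simple_edges_of_rel); apply: eq_bigr => x _.
by apply: eq_card => y; rewrite inE edges_of_relE.
Qed.

(** The relation is a matching, so the number of vertices it covers is its degree sum, twice its
    number of edges. *)
Lemma even_card_matched :
  (forall x y z, adj x y -> adj x z -> y = z) ->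
  ~~ odd #|[set x | [exists y, adj x y]]|.
Proof.
move=> fun_adj; suff -> : #|[set x | [exists y, adj x y]]| = \sum_x #|adj x|.
  by rewrite card_edges_of_rel oddM andbF.
rewrite -sum_pred_card; apply: eq_bigr => x _.
case: existsP => [[y xy]|no]; last first.
  by rewrite eq_card0 // => y; apply/negP=> xy; case: no; exists y.
rewrite (@eq_card1 _ y) // => z; rewrite [RHS]inE.
by apply/idP/eqP => [xz|->//]; apply: fun_adj xz xy.
Qed.

Lemma coloring_of_rel (col : V -> V -> nat) :
  (forall x y, col x y = col y x) ->
  (forall x y z, adj x y -> adj x z -> col x y = col x z -> y = z) ->
  exists c : {set V} -> nat, proper_coloring (edges_of_rel adj) c /\
    forall x y, adj x y -> c [set x; y] = col x y.
Proof.
move=> colC colP.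
(* As [col] is symmetric, the color of an edge does not depend on the orientation picked; 0 is the
   value off the edges. *)
pose c (e : {set V}) := odflt 0 (omap (fun p => col p.1 p.2)
  [pick p : V * V | adj p.1 p.2 && (e == [set p.1; p.2])]).
have cE x y : adj x y -> c [set x; y] = col x y.
  move=> xy; rewrite /c; case: pickP => [[a b] /= /andP[ab /eqP]|/(_ (x, y))] /=.
    by case/(set2_eq (adj_neq ab)) => -[-> ->] //; apply: colC.
  by rewrite xy eqxx.
exists c; split=> // e f /imsetP[[x y] /= xy ->] /imsetP[[a b] /= ab ->].
move=> ne /set0Pn[z]; rewrite !inE.
suff H p q : adj z p -> adj z q -> [set z; p] != [set z; q] ->
             c [set z; p] <> c [set z; q].
  have sw p q : [set p; q] = [set q; p] :> {set V} by rewrite setUC.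
  case/andP=> /orP[]/eqP zE1 /orP[]/eqP zE2; move: xy ab ne; rewrite -zE1 -zE2 !inE /=.
  - exact: H.
  - by rewrite (sw a) (adj_sym a); apply: H.
  - by rewrite (sw x) (adj_sym x); apply: H.
  - by rewrite (sw x) (adj_sym x) (sw a) (adj_sym a); apply: H.
move=> zp zq pq; rewrite !cE // => /(colP _ _ _ zp zq) E.
by rewrite E eqxx in pq.
Qed.
End GraphOfRelation.

(** In a proper coloring the edges at the center [g ord0] have distinct colors, so being rainbow
    only concerns the edge from [g (inord 1)] to [g ord_max], which misses the center. *)
Definition rainbow_broom (V : finType) (adj : rel V) (col : V -> V -> nat)
    (k : nat) (g : 'I_k.+1 -> V) : Prop :=
  [/\ injective g, forall j : 'I_k.+1, 0 < j < k -> adj (g ord0) (g j),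
      adj (g (inord 1)) (g ord_max)
    & forall j : 'I_k.+1, 0 < j < k ->
        col (g (inord 1)) (g ord_max) <> col (g ord0) (g j)].

Lemma broom_star (k : nat) (j : 'I_k.+1) : 0 < j < k -> [set ord0; j] \in broom k.
Proof.
move=> jk; rewrite inE; apply/existsP; exists ord0; apply/existsP; exists j.
by rewrite !eqxx jk.
Qed.

Lemma broom_handle (k : nat) : 0 < k -> [set inord 1; ord_max] \in broom k.
Proof.
move=> k0; rewrite inE; apply/existsP; exists (inord 1); apply/existsP; exists ord_max.
by rewrite !eqxx inordK ?ltnS //= orbT.
Qed.

Lemma rainbow_free_of_rel (V : finType) (adj : rel V) (col : V -> V -> nat)
    (c : {set V} -> nat) (k : nat) : 2 <= k ->
  symmetric adj -> irreflexive adj ->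
  (forall x y, adj x y -> c [set x; y] = col x y) ->
  (forall g, ~ @rainbow_broom V adj col k g) ->
  rainbow_free (broom k) (edges_of_rel adj) c.
Proof.
move=> k2 adjS adjI cE no [W [D [[DE _] [g [gI _ Dg]] rD]]]; apply: (no g).
have inD e : e \in broom k -> g @: e \in D by move=> ek; rewrite Dg imset_f.
have im2 a b : g @: [set a; b] = [set g a; g b].
  by rewrite imsetU !imset_set1.
have star (j : 'I_k.+1) : 0 < j < k -> [set g ord0; g j] \in D.
  by move/broom_star/inD; rewrite im2.
have handle : [set g (inord 1); g ord_max] \in D.
  by rewrite -im2 inD // broom_handle // ltnW.
have adjD x y : [set x; y] \in D -> adj x y.
  by move/(subsetP DE); rewrite edges_of_relE.
split=> // [j /star/adjD//| | j jk]; first exact: adjD.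
rewrite -!cE; [|exact/adjD/star|exact: adjD].
move/(rD _ _ handle (star _ jk)); rewrite -!im2 => /imset_inj -/(_ gI) E.
have : ord0 \in [set (inord 1 : 'I_k.+1); ord_max] by rewrite E set21.
by rewrite !inE -!val_eqE /= inordK; move: k2; case: (k) => [|[]].
Qed.

Lemma card_rel_pairs (T : finType) (adj : rel T) :
  #|[set p : T * T | adj p.1 p.2]| = \sum_x #|adj x|.
Proof.
rewrite -sum_pred_card -(pair_bigA _ (fun x y => adj x y : nat)) /=.
by apply: eq_bigr => x _; rewrite sum_pred_card cardsE.
Qed.

Lemma rainbow_ex_ge (n : nat) (U : finType) (F : {set {set U}})
    (E : {set {set 'I_n}}) (c : {set 'I_n} -> nat) :
  simple_graph E -> proper_coloring E c -> rainbow_free F E c ->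
  #|E| <= rainbow_ex n F.
Proof.
move=> sE pE fE; rewrite /rainbow_ex.
apply: (@leq_bigmax_cond _ _ (fun E : {set {set 'I_n}} => #|E|)).
by rewrite sE /=; apply/boolp.asboolP; exists c.
Qed.

(** A vertex [x] is split into the index [blk x] of its copy and its place [pos x] there. A broom is
    connected, so it lies in one copy. Edges are counted as ordered pairs, whence the factor 2. *)
Lemma rainbow_ex_disjoint_copies (k : nat) (T : finType) (adj : rel T)
    (col : T -> T -> nat) (n : nat) : 2 <= k -> 0 < #|T| ->
  symmetric adj -> irreflexive adj ->
  (forall x y, col x y = col y x) ->
  (forall x y z, adj x y -> adj x z -> col x y = col x z -> y = z) ->
  (forall g, ~ @rainbow_broom T adj col k g) ->
  (n %/ #|T|) * \sum_x #|adj x| <= rainbow_ex n (broom k) * 2.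
Proof.
move=> k2 T0 adjS adjI colC colP no; have /card_gt0P[x0 _] := T0.
pose pos (x : 'I_n) : T := nth x0 (enum T) (x %% #|T|).
pose blk (x : 'I_n) := x %/ #|T|.
have posI x y : blk x = blk y -> pos x = pos y -> x = y.
  move=> bxy /eqP; rewrite nth_uniq ?enum_uniq -?cardE ?ltn_mod //.
  move=> /eqP mxy; apply: val_inj; rewrite /= (divn_eq x #|T|) (divn_eq y #|T|).
  by rewrite -/(blk x) bxy mxy.
pose adj' x y := (blk x == blk y) && adj (pos x) (pos y).
have adjS' : symmetric adj' by move=> x y; rewrite /adj' eq_sym adjS.
have adjI' : irreflexive adj' by move=> x; rewrite /adj' adjI andbF.
have [||c [pc cE]] := @coloring_of_rel _ _ adjS' adjI' (fun x y => col (pos x) (pos y)).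
- by move=> x y; apply: colC.
- move=> x y z /andP[/eqP bxy xy] /andP[/eqP bxz xz] /(colP _ _ _ xy xz).
  by apply: posI; rewrite -bxy.
have free : rainbow_free (broom k) (edges_of_rel adj') c.
  apply: (rainbow_free_of_rel k2 adjS' adjI' cE) => g [gI gstar ghandle gcol].
  have blk1 : blk (g (inord 1)) = blk (g ord0).
    have /gstar /andP[/eqP-> //] : 0 < (inord 1 : 'I_k.+1) < k by rewrite inordK; lia.
  have blkg j : blk (g j) = blk (g ord0).
    case: (ltnP j k) => jk; last first.
      have -> : j = ord_max by apply: val_inj => /=; have := ltn_ord j; lia.
      by case/andP: ghandle => /eqP <- _.
    case: (posnP j) => j0; first by have -> : j = ord0 by apply: val_inj.
    by have /gstar /andP[/eqP-> //] : 0 < j < k by rewrite j0.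
  apply: (no (pos \o g)); split=> [i j|j /gstar/andP[]//| |//].
    by move=> /= E; apply: gI; apply: posI => //; rewrite !blkg.
  by case/andP: ghandle.
apply: leq_trans (leq_mul (rainbow_ex_ge _ pc free) (leqnn 2)); last first.
  exact: simple_edges_of_rel.
rewrite -card_edges_of_rel // -!card_rel_pairs.
set q := n %/ #|T|.
have lt_idx (b : 'I_q) (s : T) : b * #|T| + enum_rank s < n.
  apply: (@leq_trans (b.+1 * #|T|)); first by rewrite mulSn addnC ltn_add2r ltn_ord.
  by apply: leq_trans (leq_trunc_div n #|T|); rewrite leq_mul2r ltn_ord orbT.
pose idx b s := Ordinal (lt_idx b s).
have blk_idx b s : blk (idx b s) = b.
  by rewrite /blk /= divnMDl // divn_small ?addn0 // ltn_ord.
have pos_idx b s : pos (idx b s) = s.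
  by rewrite /pos /= modnMDl modn_small ?ltn_ord // nth_enum_rank.
rewrite -[X in X * _](card_ord q) -cardsT -cardsX.
rewrite -(card_imset (f := fun p => (idx p.1 p.2.1, idx p.1 p.2.2))); last first.
  move=> [b [s t]] [b' [s' t']] /= [E1 E2].
  have E (a a' : 'I_q) (u u' : T) : a * #|T| + enum_rank u = a' * #|T| + enum_rank u' ->
      a = a' /\ u = u'.
    move=> E; have Ei : idx a u = idx a' u' by apply: val_inj.
    split; last by rewrite -(pos_idx a u) Ei pos_idx.
    by apply: val_inj; rewrite /= -(blk_idx a u) Ei blk_idx.
  by have [-> ->] := E _ _ _ _ E1; have [_ ->] := E _ _ _ _ E2.
apply: subset_leq_card; apply/subsetP=> p /imsetP[[b [s t]]]; rewrite !inE /= => st ->.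
by rewrite /adj' /= !blk_idx !pos_idx eqxx.
Qed.

(** * Lower bounds *)

Section CompleteFactorization.
Variables (C T : finType) (adj : rel T) (col : T -> T -> C) (mu : C -> option T).
Hypotheses (pf : partial_factorization adj col mu) (cardT : #|T| = #|C|.+1).

Lemma complete_sees x c : mu c != Some x -> sees adj col x c.
Proof.
move=> mux; case: (boolP (sees adj col x c)) => // nsee.
have [j] := pf_lack pf c; rewrite cardT (cardsD1 x) inE /lacks mux nsee /=.
by move: #|_ :\ _| #|C| => a b; lia.
Qed.

(* A center of a broom on #|C| + 1 vertices has degree at least #|C| - 1, hence
   #|C|, so it sees all the colors, and that of the handle edge not incident to
   it is the color of a bristle. *)
Lemma complete_no_rainbow_broom :
  0 < #|C| -> (forall x, #|[set c | mu c == Some x]| != 1) ->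
  forall g, ~ @rainbow_broom T adj (fun x y => enum_rank (col x y)) #|C| g.
Proof.
move=> C0 mu1 g [gI gstar ghandle gcol].
have gS y : y \in codom g by apply: inj_card_onto; rewrite // card_ord cardT.
have mu0 c : mu c != Some (g ord0).
  (* A broom spans all the vertices here, so besides itself the center can only be non-adjacent to
     [g ord_max]. *)
  have le2 : #|~: [set y | adj (g ord0) y]| <= 2.
    apply: (@leq_trans #|[set g ord0; g ord_max]|); last by rewrite cards2; case: (_ != _).
    apply: subset_leq_card; apply/subsetP=> y; rewrite !inE.
    have /codomP[j ->] := gS y; apply: contraR; rewrite negb_or !(inj_eq gI).
    rewrite -!val_eqE /= => /andP[j0 jk]; apply: gstar.
    by rewrite lt0n j0 ltn_neqAle jk -ltnS ltn_ord.
  have arith (a b d e : nat) :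
    a <= 2 -> b != 1 -> (d + b).+1 = e -> d + a = e -> b = 0 by lia.
  have := arith _ _ _ _ le2 (mu1 (g ord0)) (pf_deg pf (g ord0)).
  rewrite -(cardsC [set y | adj (g ord0) y]) (cardsE (adj _)) => /(_ erefl).
  by move/cards0_eq/setP/(_ c); rewrite !inE => ->.
(* The center sees the color of the outer edge through some [y]. If [y] is [g ord_max], this color
   occurs twice at [y]; otherwise the broom is not rainbow. *)
have /existsP[y /andP[zy /eqP ycol]] :=
  complete_sees (mu0 (col (g (inord 1)) (g ord_max))).
have /codomP[j yj] := gS y.
case: (posnP j) => j0.
  have jE : j = ord0 by apply: val_inj.
  by move: zy; rewrite yj jE (pf_irr pf).
case: (ltnP j #|C|) => jk.
  have jj : 0 < j < #|C| by rewrite j0.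
  by apply: (gcol j jj); rewrite -yj ycol.
have jE : j = ord_max.
  by apply: val_inj => /=; apply/eqP; rewrite eqn_leq jk -ltnS ltn_ord.
have gy : g ord_max = y by rewrite yj jE.
rewrite gy in ghandle ycol.
have := @pf_proper _ _ _ _ _ pf y (g (inord 1)) (g ord0).
rewrite !(pf_sym pf y) zy ghandle => /(_ isT isT).
rewrite !(pf_colC pf y) ycol => /(_ erefl) /gI.
by move/(congr1 val) => /=; rewrite inordK.
Qed.

Lemma complete_degree_sum :
  \sum_x #|adj x| + #|[set c | mu c != None]| = #|C| * #|C|.+1.
Proof.
have -> : #|[set c | mu c != None]| = \sum_x #|[set c | mu c == Some x]|.
  under [RHS]eq_bigr => x _ do rewrite -sum_pred_card.
  rewrite exchange_big /= -sum_pred_card; apply: eq_bigr => c _.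
  case: (mu c) => [x|] /=; last by rewrite big1.
  by rewrite (bigD1 x) //= eqxx big1 // => y yx; rewrite (inj_eq Some_inj) eq_sym (negbTE yx).
rewrite -big_split /= mulnC -cardT -sum_nat_const; apply: eq_bigr => x _.
by have := pf_deg pf x; rewrite cardT => -[].
Qed.
End CompleteFactorization.

Lemma rainbow_ex_factorization (C T : finType) (adj : rel T) (col : T -> T -> C)
    (mu : C -> option T) (n : nat) :
  2 <= #|C| -> partial_factorization adj col mu ->
  (forall x, #|[set c | mu c == Some x]| != 1) ->
  (n %/ #|C|.+1) * (#|C| * #|C|.+1 - #|[set c | mu c != None]|) <=
    rainbow_ex n (broom #|C|) * 2.
Proof.
move=> C2 pf mu1; have /card_gt0P[c0 _] : 0 < #|C| by apply: leq_trans C2.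
have [T' [adj' [col' [mu' [pf' cT mu1' muN]]]]] := partial_factorization_complete c0 pf mu1.
have -> : [set c | mu c != None] = [set c | mu' c != None].
  by apply/setP=> c; rewrite !inE muN.
rewrite -(complete_degree_sum pf' cT) addnK -[X in _ %/ X]cT.
apply: (@rainbow_ex_disjoint_copies _ _ adj' (fun x y => enum_rank (col' x y))) => //.
- by rewrite cT.
- exact: (pf_sym pf').
- exact: (pf_irr pf').
- by move=> x y; rewrite (pf_colC pf').
- by move=> x y z xy xz /val_inj/enum_rank_inj; apply: (pf_proper pf').
- by apply: complete_no_rainbow_broom pf' cT _ mu1'; apply: leq_trans C2.
Qed.

(** The empty graph without reserved colors extends to a 1-factorization of the complete graph on
    [k.+1] vertices; the parity clause holds because [k.+1] is even. *)
Lemma rainbow_ex_ge_odd (k n : nat) : 2 <= k -> odd k ->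
  (n %/ k.+1) * (k * k.+1) <= rainbow_ex n (broom k) * 2.
Proof.
move=> k2 ok.
have pf : @partial_factorization 'I_k void (fun _ _ => false)
   (fun x _ => match x with end) (fun _ => None).
  split; try by case.
  move=> c; exists k.+1./2; rewrite card_void addn0 card_ord -[RHS]odd_double_half /= ok.
  by rewrite (_ : [set x | _] = set0) ?cards0 //; apply/setP; case.
have := @rainbow_ex_factorization _ _ _ _ _ n _ pf; rewrite card_ord.
rewrite (_ : [set c | _] = set0) ?cards0 ?subn0; last by apply/setP=> c; rewrite !inE.
by apply=> //; case.
Qed.

(** A complete graph on [k] vertices is too small to contain the broom, so each edge may get its own
    color. *)
Lemma rainbow_ex_ge_clique (k n : nat) : 2 <= k ->
  (n %/ k) * (k * k.-1) <= rainbow_ex n (broom k) * 2.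
Proof.
move=> k2; pose col (x y : 'I_k) : nat := enum_rank [set x; y].
have := @rainbow_ex_disjoint_copies k 'I_k (fun x y => x != y) col n k2; rewrite card_ord.
rewrite (eq_bigr (fun=> k.-1)) ?sum_nat_const ?card_ord; last first.
  by move=> x _; rewrite -[k in RHS]card_ord -(cardC1 x); apply: eq_card => y; rewrite !inE eq_sym.
apply.
- exact: ltnW.
- by move=> x y; rewrite eq_sym.
- by move=> x; rewrite eqxx.
- by move=> x y; rewrite /col setUC.
- move=> x y z xy xz /val_inj/enum_rank_inj /(set2_eq xz) [[]//|[xz' _]].
  by rewrite xz' eqxx in xz.
- by move=> g [/leq_card]; rewrite !card_ord ltnn.
Qed.

(* Two hubs and [r.+1] leaves; the non-edges form a complete bipartite graph
   between hubs and leaves, together with the edge between the two hubs if [b]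
   holds. The edges between leaves only use colors reserved for a hub. *)
Section HubsAndLeaves.
Variables (r : nat) (b : bool).

Local Notation vertex := (bool + 'I_r.+1)%type.
Local Notation color := (bool * 'I_(r + b).+1 + bool * 'I_r.+1)%type.

Definition hub_adj : rel vertex := fun u v =>
  match u, v with
  | inl h, inl h' => (h != h') && ~~ b
  | inr i, inr j => i != j
  | _, _ => false
  end.

(** The sum modulo [r.+1] is the usual proper coloring of the complete graph on the leaves, with
    colors reserved for the hub [true]; an edge between the hubs takes a color reserved for a
    leaf. *)
Definition hub_col (u v : vertex) : color :=
  match u, v with
  | inr i, inr j => inl (true, inord ((i + j) %% r.+1))
  | _, _ => inr (true, ord0)
  end.

(** Each vertex gets as many colors as it has non-neighbors: for a hub the [r.+1] leaves, and the
    other hub if [b]; for a leaf the two hubs. *)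
Definition hub_mu (c : color) : option vertex :=
  match c with inl (h, _) => Some (inl h) | inr (_, i) => Some (inr i) end.

Lemma card_hub_mu x : #|[set c | hub_mu c == Some x]| =
  if x is inl _ then (r + b).+1 else 2.
Proof.
case: x => [h|i].
- rewrite (_ : [set c | _] = [set inl (h, j) | j : 'I_(r + b).+1]).
    by rewrite card_imset ?card_ord // => j j' [].
  apply/setP=> -[[h' j]|[h' j]]; rewrite !inE /=; apply/eqP/imsetP.
  + by case=> ->; exists j.
  + by case=> j' _ [-> _].
  + by [].
  + by case.
- rewrite (_ : [set c | _] = [set inr (h, i) | h : bool]).
    by rewrite card_imset ?card_bool // => h h' [].
  apply/setP=> -[[h' j]|[h' j]]; rewrite !inE /=; apply/eqP/imsetP.
  + by [].
  + by case.
  + by case=> ->; exists h'.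
  + by case=> h _ [_ ->].
Qed.

Lemma card_hub_adj x : #|hub_adj x| = if x is inl _ then (~~ b : nat) else r.
Proof.
case: x => [h|i].
- case: (boolP b) => /= hb.
    by apply: eq_card0 => -[h'|j] //; rewrite /in_mem /= hb andbF.
  apply: (@eq_card1 _ (inl (~~ h))) => -[h'|j] //.
  by rewrite /in_mem /= hb andbT; case: h h' => -[].
- transitivity #|predC1 i|; last by rewrite cardC1 card_ord.
  rewrite -(card_imset (f := @inr bool 'I_r.+1)); last by move=> j j' [].
  apply: eq_card => -[h|j]; apply/idP/imsetP => //.
  + by case.
  + by move=> ij; exists j; rewrite ?inE // eq_sym.
  + by case=> j'; rewrite inE => ij' [->]; rewrite /in_mem /= eq_sym.
Qed.

(** Every color is reserved for exactly one vertex, which does not see it, and it is seen by an even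
    number of vertices, being a matching; this gives the parity in [pf_lack]. *)
Lemma hub_partial_factorization : partial_factorization hub_adj hub_col hub_mu.
Proof.
have adjS : symmetric hub_adj by case=> [h|i] [h'|j] //=; rewrite eq_sym.
have adjI : irreflexive hub_adj by case=> [h|i] /=; rewrite eqxx.
have colC x y : hub_col x y = hub_col y x.
  by case: x y => [h|i] [h'|j] //=; rewrite (addnC i j).
have colP x y z : hub_adj x y -> hub_adj x z -> hub_col x y = hub_col x z -> y = z.
  case: x y z => [h|i] [h'|j] [h''|j'] //=.
    by case: b h h' h'' => -[] [] [].
  move=> _ _ [] /(congr1 val) /=.
  have lt (a : nat) : a %% r.+1 < (r + b).+1.
    by apply: leq_trans (ltn_pmod _ _) _ => //; rewrite ltnS leq_addr.
  rewrite !inordK // => /eqP; rewrite eqn_modDl !modn_small ?ltn_ord //.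
  by move/eqP/val_inj->.
have colmu x y : hub_adj x y -> hub_mu (hub_col x y) != Some x.
  by case: x y => [h|i] [h'|j].
have cardT : #|{: vertex}| = r.+3 by rewrite card_sum card_bool card_ord.
split=> // [x|c].
  by rewrite card_hub_adj card_hub_mu cardT; case: x => _; case: b => /=; lia.
have [u mucu] : exists u, hub_mu c = Some u.
  by case: c => -[h i]; [exists (inl h)|exists (inr i)].
pose R x y := hub_adj x y && (hub_col x y == c).
have /even_halfK evenR : ~~ odd #|[set x | sees hub_adj hub_col x c]|.
  apply: (@even_card_matched _ R) => [x y|x|x y z].
  - by rewrite /R adjS colC.
  - by rewrite /R adjI.
  - move=> /andP[xy /eqP Ey] /andP[xz /eqP Ez]; apply: colP xy xz _; by rewrite Ey.
have E : #|[set x | lacks hub_adj hub_col hub_mu x c]| +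
         #|[set x | sees hub_adj hub_col x c]| + 1 = r.+3.
  rewrite -cardT -[in RHS](cardsC [set x | lacks hub_adj hub_col hub_mu x c]).
  rewrite -addnA; congr (_ + _).
  rewrite (cardsD1 u (~: _)) addnC !inE /lacks mucu eqxx /=; congr (_ + _).
  apply: eq_card => x; rewrite !inE (inj_eq Some_inj) negb_and !negbK eq_sym.
  case: (eqVneq u x) => [<-|] //=; apply/negbTE/negP=> /existsP[y /andP[uy /eqP cE]].
  by move: (colmu _ _ uy); rewrite cE mucu eqxx.
(* If [s] vertices see [c], then [r + 2 - s] lack it, and [(r + 2 - s) + (r + 3) + 2 * (r + b) + s]
   is the number of colors plus one. *)
exists (r + b + #|[set x | sees hub_adj hub_col x c]|./2).
rewrite doubleD evenR cardT card_sum !card_prod !card_ord card_bool.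
by move: E; move: #|_| #|_| => x y; rewrite -addnn; lia.
Qed.
End HubsAndLeaves.

(** All [k] colors are reserved, so each copy has degree sum [k * k.+1 - k = k ^ 2]. *)
Lemma rainbow_ex_ge_even (k n : nat) : 6 <= k -> ~~ odd k ->
  (n %/ k.+1) * k ^ 2 <= rainbow_ex n (broom k) * 2.
Proof.
(* These values solve [k = 4 * r.+1 + 2 * b], the number of colors. *)
move=> k6 ek; pose r := (k./2./2).-1; pose b := odd k./2.
have kE : k = (r.+1 + r.+1 + b).*2.
  rewrite -[LHS]even_halfK // -[in LHS](odd_double_half k./2) -/b addnC -addnn.
  by rewrite /r; lia.
have C : #|{: bool * 'I_(r + b).+1 + bool * 'I_r.+1}| = k.
  by rewrite card_sum !card_prod !card_ord card_bool [RHS]kE -addnn; lia.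
have := @rainbow_ex_factorization _ _ _ _ _ n _ (@hub_partial_factorization r b).
rewrite [X in _ * (_ - X)](_ : _ = k); last first.
  by rewrite -[RHS]C; apply: eq_card => -[[]|[]] *; rewrite !inE.
rewrite C (_ : k * k.+1 - k = k ^ 2); last by rewrite mulnS addKn.
apply; first by lia.
case=> [h|i]; rewrite card_hub_mu //.
(* A hub has [(r + b).+1] reserved colors, which is 1 only for [k = 4]. *)
by move: k6; rewrite kE -addnn; lia.
Qed.

(** * Upper bounds *)

Section ProperColoring.
Variables (V : finType) (E : {set {set V}}) (c : {set V} -> nat).
Hypotheses (simpleE : simple_graph E) (properE : proper_coloring E c).

Local Notation N := (neighbors E).

Lemma in_neighborsC x y : (y \in N x) = (x \in N y).
Proof. by rewrite !inE setUC. Qed.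

Lemma notin_neighbors x : x \notin N x.
Proof. by rewrite inE; apply/negP => /(edge_neq simpleE); rewrite eqxx. Qed.

Lemma proper_neighbors x y z : y \in N x -> z \in N x ->
  c [set x; y] = c [set x; z] -> y = z.
Proof.
rewrite !inE => xy xz cE; apply/eqP/negPn/negP => yz.
apply: (properE xy xz) cE.
  apply/eqP => /(set2_eq (edge_neq simpleE xz)) [[_ yz']|[xz' _]].
    by rewrite yz' eqxx in yz.
  by have := edge_neq simpleE xz; rewrite xz' eqxx.
by apply/set0Pn; exists x; rewrite !inE eqxx.
Qed.

Definition has_color (x : V) (a : nat) : bool :=
  [exists y, (y \in N x) && (c [set x; y] == a)].

(** The bristles are taken among the neighbors of [z] counted here; the colors of [zy] and [yx]
    differ because these edges share [y]. *)
Lemma rainbow_broom_exists k z y x : 2 <= k ->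
  y \in N z -> x \in N y -> x != z ->
  k - 2 <= #|[set w in N z | [&& w != y, w != x & c [set z; w] != c [set y; x]]]| ->
  ~ rainbow_free (broom k) E c.
Proof.
move=> k2 zy yx xz; set A := [set w in _ | _] => leA.
pose t := take (k - 2) (enum A).
have szt : size t = k - 2 by rewrite size_takel // -cardE.
have tA w : w \in t -> w \in A by move/mem_take; rewrite mem_enum.
have zNz := notin_neighbors z.
have nzy : z != y by apply: (edge_neq simpleE); rewrite inE in zy.
have nyx : y != x by apply: (edge_neq simpleE); rewrite inE in yx.
(* This follows the numbering of [broom]: center, [y], bristles, [x]. *)
pose s := [:: z, y & rcons t x].
have szs : size s = k.+1 by rewrite /= size_rcons szt; lia.
have us : uniq s.
  rewrite /= inE mem_rcons inE rcons_uniq take_uniq ?enum_uniq // andbT.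
  rewrite mem_rcons inE !negb_or (eq_sym z x) xz nzy nyx /=.
  apply/and3P; split; apply/negP => /tA; rewrite inE.
  - by rewrite (negbTE zNz).
  - by rewrite eqxx andbF.
  - by rewrite eqxx !andbF.
pose g (i : 'I_k.+1) := nth z s i.
have gI : injective g.
  by move=> i j /eqP; rewrite nth_uniq ?szs ?ltn_ord // => /eqP/val_inj.
have im2 a b : g @: [set a; b] = [set g a; g b].
  by rewrite imsetU !imset_set1.
have gstar (j : 'I_k.+1) : 0 < j < k -> g j = y \/ g j \in A.
  rewrite /g; case: (nat_of_ord j) => [|[|i]] //= ik; first by left.
  right; rewrite nth_rcons szt; have ik' : i < k - 2 by lia.
  by rewrite ik'; apply/tA/mem_nth; rewrite szt.
pose D := [set g @: e | e : {set 'I_k.+1} in broom k].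
have DP e : e \in D -> (exists w, [/\ w \in N z, e = [set z; w] &
    c [set z; w] <> c [set y; x]]) \/ e = [set y; x].
  case/imsetP=> e0; rewrite inE => /existsP[i /existsP[j /andP[/eqP-> ij]]] ->.
  rewrite im2; case/orP: ij => /andP[/eqP i0 jk]; [left|right].
    exists (g j); have -> : g i = z by rewrite /g i0.
    case: (gstar j jk) => [->|].
      split=> //; rewrite setUC => /proper_neighbors zx.
      by move: xz; rewrite (zx _ yx) ?eqxx // in_neighborsC.
    by rewrite inE => /and4P[? _ _ /eqP].
  rewrite /g i0 (eqP jk) /=; congr [set _; _].
  move: szt k2; case: (k) => [|[|k']] //= szt _.
  by rewrite nth_rcons szt subn2 /= ltnn eqxx.
apply; exists (g @: setT), D; split.
- split=> [|e /imsetP[e0 _ ->]]; last by apply: imsetS; apply: subsetT.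
  apply/subsetP=> e /DP[[w [wz -> _]]|->]; first by rewrite inE in wz.
  by rewrite inE in yx.
- by exists g.
- move=> e f /DP[[w [wz -> wc]]|->] /DP[[w' [wz' -> wc']]|->] //.
  + by move/(proper_neighbors wz wz') ->.
  + by move/esym.
Qed.

Section RainbowFree.
Variable k : nat.
Hypotheses (k_ge2 : 2 <= k) (freeE : rainbow_free (broom k) E c).

(** Besides [y], only [x] and the neighbor joined to [z] in the color of [yx] are unfit as bristles,
    and fewer than [k - 2] neighbors of [z] are fit. *)
Lemma degree_bound z y x : y \in N z -> x \in N y -> x != z ->
  #|N z| < k.-1 + (x \in N z) + has_color z (c [set y; x]).
Proof.
move=> zy yx xz; set a := c _.
set A := [set w in N z | [&& w != y, w != x & c [set z; w] != a]].
have ltA : #|A| < k - 2.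
  by rewrite ltnNge; apply/negP => /(rainbow_broom_exists k_ge2 zy yx xz).
pose W := [set w in N z | c [set z; w] == a].
have leW : #|W| <= has_color z a.
  case: (boolP (has_color z a)) => [_|no] /=.
    apply/card_le1_eqP => w w'; rewrite !inE -/(N z) => /andP[wz /eqP wa] /andP[wz' /eqP wa'].
    by apply: (@proper_neighbors z); rewrite ?inE // wa.
  rewrite leqn0 cards_eq0; apply/eqP/setP=> w; rewrite in_set in_set0.
  by apply: contraNF no => wa; apply/existsP; exists w.
have leX : #|[set x] :&: N z| <= (x \in N z).
  case: (boolP (x \in N z)) => xNz /=; first by rewrite -(cards1 x) subset_leq_card // subsetIl.
  rewrite leqn0 cards_eq0; apply/eqP/setP=> w; rewrite in_setI in_set0 in_set1.
  by apply: contraNF xNz => /andP[/eqP->].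
have leN : #|N z| <= #|A| + 1 + #|[set x] :&: N z| + #|W|.
  apply: leq_trans (_ : #|A :|: [set y] :|: ([set x] :&: N z) :|: W| <= _).
    apply: subset_leq_card; apply/subsetP=> w wz.
    rewrite !(in_setU, in_setI, in_set1) [w \in A]in_set [w \in W]in_set wz /=.
    by case: (w == y); case: (w == x); case: (_ == a).
  rewrite -(cards1 y); do 2! [apply: leq_trans (leq_card_setU _ _) _; rewrite leq_add2r].
  exact: leq_card_setU.
have arith (d a' b1 b2 i j : nat) :
  a' < k - 2 -> b2 <= j -> b1 <= i -> d <= a' + 1 + b1 + b2 -> d < k.-1 + i + j by lia.
exact: arith ltA leW leX leN.
Qed.

(** Above degree [k], [degree_bound] fails even if both of its corrections are 1. *)
Lemma big_degree_star v y : k < #|N v| -> y \in N v -> N y = [set v].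
Proof.
move=> dv vy; apply/setP=> x; rewrite in_set1; apply/idP/eqP => [yx|->]; last first.
  by rewrite in_neighborsC.
apply/eqP/negPn/negP => xv; have := degree_bound vy yx xv.
by case: (x \in N v); case: (has_color _ _) => /=; lia.
Qed.

(** At degree [k], [degree_bound] needs both of its corrections. *)
Lemma degree_k_closed v y x : #|N v| = k -> y \in N v -> x \in N y -> x != v ->
  x \in N v /\ has_color v (c [set y; x]).
Proof.
move=> dv vy yx xv; have := degree_bound vy yx xv.
by case: (x \in N v); case: (has_color _ _) => //=; lia.
Qed.

Lemma degree_pred_k z y x : #|N z| = k.-1 -> y \in N z -> x \in N y -> x != z ->
  x \notin N z -> has_color z (c [set y; x]).
Proof.
move=> dz zy yx xz xNz; have := degree_bound zy yx xz; rewrite (negbTE xNz).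
by case: (has_color _ _) => //=; lia.
Qed.
End RainbowFree.
End ProperColoring.

(** * Averaging degrees over closed sets *)

Section ClosedSets.
Variables (V : finType) (E : {set {set V}}).

Local Notation N := (neighbors E).

Definition closed_set (S : {set V}) : Prop := forall x, x \in S -> N x \subset S.

(** The closed neighborhood of a vertex of degree above [p / q] has average degree at most [p / q]
    and is split off; once no such vertex is left, every degree is at most [p / q]. *)
Lemma degree_sum_closed (p q : nat) (U : {set V}) :
  (forall v, p < q * #|N v| -> closed_set (v |: N v) /\
     q * \sum_(x in v |: N v) #|N x| <= p * #|v |: N v|) ->
  closed_set U -> q * \sum_(x in U) #|N x| <= p * #|U|.
Proof.
move=> big; have [m] := ubnP #|U|; elim: m U => // m IH U leU cU.
case: (pickP (fun v => (v \in U) && (p < q * #|N v|))) => [v /andP[vU /big[cS leS]]|small].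
  set S := v |: N v in cS leS.
  have SU : S \subset U by rewrite subUset sub1set vU cU.
  have cD : closed_set (U :\: S).
    move=> x; rewrite inE => /andP[xS xU]; apply/subsetP=> y xy; rewrite inE.
    rewrite (subsetP (cU x xU)) // andbT; apply: contra xS => yS.
    by apply: (subsetP (cS y yS)); rewrite in_neighborsC.
  have ltD : #|U :\: S| < m.
    rewrite -ltnS; apply: leq_trans leU; rewrite ltnS; apply: proper_card.
    rewrite properEneq subsetDl andbT; apply/negP => /eqP/setP/(_ v).
    by rewrite !inE vU eqxx.
  have leD := IH _ ltD cD; rewrite (big_setID S) /= (setIidPr SU) mulnDr.
  rewrite -(cardsID S U) (setIidPr SU) mulnDr.
  exact: leq_add.
rewrite big_distrr /= mulnC -sum_nat_const; apply: leq_sum => x xU.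
by rewrite leqNgt; have := small x; rewrite xU /= => ->.
Qed.

Hypothesis simpleE : simple_graph E.

Lemma edge_bound (p q : nat) :
  (forall v, p < q * #|N v| -> closed_set (v |: N v) /\
     q * \sum_(x in v |: N v) #|N x| <= p * #|v |: N v|) ->
  q * (#|E| * 2) <= p * #|V|.
Proof.
move=> big; rewrite -handshake // -cardsT.
rewrite (eq_bigl (fun x => x \in [set: V])) => [|x]; last by rewrite in_setT.
by apply: degree_sum_closed big _ => x _; apply: subsetT.
Qed.
End ClosedSets.

(** * Components of vertices of degree at least [k] *)

Section UpperBound.
Variables (V : finType) (E : {set {set V}}) (c : {set V} -> nat) (k : nat).
Hypotheses (simpleE : simple_graph E) (properE : proper_coloring E c).
Hypotheses (k_ge2 : 2 <= k) (freeE : rainbow_free (broom k) E c).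

Local Notation N := (neighbors E).

Lemma card_closed_neighborhood v : #|v |: N v| = #|N v|.+1.
Proof. by rewrite cardsU1 notin_neighbors. Qed.

Lemma star_component (p q : nat) v : k < #|N v| ->
  q * (#|N v| * 2) <= p * #|N v|.+1 ->
  closed_set E (v |: N v) /\ q * \sum_(x in v |: N v) #|N x| <= p * #|v |: N v|.
Proof.
move=> dv le_pq; have leaf y := big_degree_star simpleE properE k_ge2 freeE dv (y := y).
split.
  move=> x; rewrite in_setU1 => /orP[/eqP->|/leaf->]; first exact: subsetUr.
  by rewrite sub1set setU11.
rewrite card_closed_neighborhood big_setU1 ?notin_neighbors //=.
rewrite (eq_bigr (fun=> 1)) => [|x /leaf->]; last by rewrite cards1.
by rewrite sum1_card addnn -muln2.
Qed.

Section DegreeK.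
Variable v : V.
Hypothesis dv : #|N v| = k.

Local Notation S := (v |: N v).

Lemma degree_k_component : closed_set E S.
Proof.
move=> x; rewrite in_setU1 => /orP[/eqP->|xv]; first exact: subsetUr.
apply/subsetP=> y yx; rewrite in_setU1; case: eqVneq => //= yv.
by have [] := degree_k_closed simpleE properE k_ge2 freeE dv xv yx yv.
Qed.

(** The colors seen by [v] are indexed by the neighbors [w] of [v]. *)
Definition missing (x w : V) : bool := ~~ has_color E c x (c [set v; w]).

Lemma component_color x y : x \in S -> y \in N x -> has_color E c v (c [set x; y]).
Proof.
rewrite in_setU1 => /orP[/eqP->|xv] xy.
  by apply/existsP; exists y; rewrite xy eqxx.
case: (eqVneq y v) => [->|yv].
  by apply/existsP; exists x; rewrite xv setUC eqxx.
by have [] := degree_k_closed simpleE properE k_ge2 freeE dv xv xy yv.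
Qed.

(** The edges at [x] have distinct colors, all seen by [v]; [f] turns these colors into neighbors of
    [v] that are not counted as missing. *)
Lemma degree_missing x : x \in S ->
  #|N x| + #|[set w in N v | missing x w]| <= k.
Proof.
move=> xS; rewrite -dv -(cardsID [set w | missing x w] (N v)) addnC.
rewrite [X in X + _](_ : _ = #|N v :&: [set w | missing x w]|); last first.
  by apply: eq_card => w; rewrite in_set in_setI in_set.
rewrite leq_add2l.
pose f y := odflt v [pick w | (w \in N v) && (c [set v; w] == c [set x; y])].
have fP y : y \in N x -> f y \in N v /\ c [set v; f y] = c [set x; y].
  move=> /(component_color xS)/existsP[w wP]; rewrite /f.
  by case: pickP => [w' /= /andP[? /eqP]|/(_ w)]; rewrite ?wP.
rewrite -(card_in_imset (f := f) (D := mem (N x))) => [|y z xy xz fE]; last first.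
  apply: (proper_neighbors simpleE properE xy xz).
  by have [_ <-] := fP _ xy; have [_ <-] := fP _ xz; rewrite fE.
apply: subset_leq_card; apply/subsetP=> w /imsetP[y xy ->].
have [fv fc] := fP _ xy; rewrite in_setD fv andbT in_set /missing negbK fc.
by apply/existsP; exists y; rewrite xy eqxx.
Qed.

(** The color matches in pairs the vertices of the component that see it, and for [k] even the
    component has an odd number of vertices, [k.+1]. *)
Lemma odd_missing w : ~~ odd k -> odd #|[set x in S | missing x w]|.
Proof.
move=> ek; pose a := c [set v; w].
pose R x y := [&& x \in S, y \in N x & c [set x; y] == a].
have evenR : ~~ odd #|[set x | [exists y, R x y]]|.
  apply: even_card_matched => [x y|x|x y z].
  - rewrite /R in_neighborsC (setUC [set x]); case: (boolP (x \in N y)) => [xy|]; rewrite ?andbF //=.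
    congr (_ && _); apply/idP/idP => [xS|yS].
      by apply: (subsetP (degree_k_component xS)); rewrite in_neighborsC.
    exact: (subsetP (degree_k_component yS)).
  - by rewrite /R (negbTE (notin_neighbors simpleE x)) andbF.
  - move=> /and3P[_ xy /eqP Ey] /and3P[_ xz /eqP Ez].
    by apply: (proper_neighbors simpleE properE xy xz); rewrite Ey.
have : odd #|S| by rewrite card_closed_neighborhood dv.
rewrite -(cardsID [set x | [exists y, R x y]] S) oddD.
rewrite [X in odd X (+) _](_ : _ = #|[set x | [exists y, R x y]]|); last first.
  apply: eq_card => x; rewrite in_setI andb_idl // in_set => /existsP[y /and3P[]//].
rewrite (negbTE evenR) /= (_ : _ :\: _ = [set x in S | missing x w]) //.
apply/setP=> x; rewrite in_setD [x \in [set _ | [exists y, _]]]in_set [RHS]in_set andbC.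
case: (boolP (x \in S)) => xS //=; congr (~~ _).
by apply: eq_existsb => y; rewrite /R xS.
Qed.

Lemma missing_double_count :
  \sum_(x in S) #|[set w in N v | missing x w]| =
  \sum_(w in N v) #|[set x in S | missing x w]|.
Proof.
under eq_bigr => x _ do rewrite card_sep_sum.
by rewrite exchange_big; apply: eq_bigr => w _; rewrite card_sep_sum.
Qed.

Hypothesis k_even : ~~ odd k.

Lemma missing_sum_ge : k <= \sum_(x in S) #|[set w in N v | missing x w]|.
Proof.
rewrite missing_double_count -{1}dv -sum1_card; apply: leq_sum => w _.
exact: odd_gt0 (odd_missing w k_even).
Qed.

Lemma degree_missing_sum :
  \sum_(x in S) (#|N x| + #|[set w in N v | missing x w]|) <= k.+1 * k.
Proof.
by rewrite -{1}dv -card_closed_neighborhood -sum_nat_const; apply: leq_sum => x /degree_missing.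
Qed.

(** Each of the [k] colors is missing somewhere, which takes at least [k] off the sum [k.+1 * k]. *)
Lemma degree_k_sum : \sum_(x in S) #|N x| <= k * k.
Proof.
have := degree_missing_sum; rewrite big_split /= mulSn.
by have := missing_sum_ge; lia.
Qed.

(** * Components attaining the bound [k * k] *)

Section Equality.
Hypothesis sum_eq : k * k <= \sum_(x in S) #|N x|.

Lemma missing_sum_eq : \sum_(x in S) #|[set w in N v | missing x w]| = k.
Proof.
apply/eqP; rewrite eqn_leq missing_sum_ge andbT.
by have := degree_missing_sum; rewrite big_split /= mulSn; move: sum_eq; lia.
Qed.

Lemma degree_missing_eq x : x \in S ->
  #|N x| + #|[set w in N v | missing x w]| = k.
Proof.
move=> xS; have := leqif_sum (fun y yS => leqif_eq (@degree_missing y yS)).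
case=> _; rewrite sum_nat_const card_closed_neighborhood dv big_split /=.
rewrite missing_sum_eq mulSn addnC eqn_add2l eqn_leq degree_k_sum sum_eq.
by move/esym/forall_inP/(_ x xS)/eqP.
Qed.

(** Each of the [k] colors is missing at an odd, hence positive, number of vertices; these numbers
    sum to [k], so all are 1. *)
Lemma missing_unique w x y : w \in N v -> x \in S -> y \in S ->
  missing x w -> missing y w -> x = y.
Proof.
have n1 u (uv : u \in N v) : 1 <= #|[set x in S | missing x u]| by
  exact: odd_gt0 (odd_missing u k_even).
move=> wv xS yS xw yw.
have [_] := leqif_sum (fun u uv => leqif_eq (n1 u uv)).
rewrite -missing_double_count missing_sum_eq sum1_card dv eqxx.
move/esym/forall_inP/(_ w wv); rewrite eq_sym => /cards1P[z zE].
have /set1P-> : x \in [set z] by rewrite -zE in_set xS.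
by have /set1P-> : y \in [set z] by rewrite -zE in_set yS.
Qed.

Lemma card_component_D1 x : x \in S -> #|S :\ x| = k.
Proof.
by move=> xS; have := cardsD1 x S; rewrite xS card_closed_neighborhood dv add1n => -[].
Qed.

(** Such an [x] has one non-neighbor [y] in the component and one missing color. An edge [yu] of
    that color would have [u] adjacent to [x], and [degree_pred_k] would make [x] see the color; so
    [y] misses it too, against uniqueness. *)
Lemma no_degree_pred_k x : x \in S -> #|N x| != k.-1.
Proof.
move=> xS; apply/eqP => dx.
have Sx : N x \subset S :\ x.
  by rewrite subsetD1 notin_neighbors // degree_k_component.
have cSx := card_component_D1 xS.
have /eqP/cards1P[y yE] : #|(S :\ x) :\: N x| = 1.
  by rewrite cardsD (setIidPr Sx) cSx dx; lia.
have : y \in (S :\ x) :\: N x by rewrite yE set11.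
rewrite in_setD in_setD1 => /and3P[yNx yx yS].
have /eqP/cards1P[w wE] : #|[set w in N v | missing x w]| = 1.
  by have := degree_missing_eq xS; rewrite dx; lia.
have : w \in [set w in N v | missing x w] by rewrite wE set11.
rewrite in_set => /andP[wv xw].
suff yw : missing y w.
  by move: yx; rewrite (missing_unique wv xS yS xw yw) eqxx.
apply/existsP => -[u /andP[uy /eqP uc]].
have uS := subsetP (degree_k_component yS) u uy.
have ux : u \in N x.
  apply/negPn/negP => uNx.
  have : u \in [set y].
    rewrite -yE in_setD uNx in_setD1 uS andbT.
    by apply: contraNneq yNx => <-; rewrite in_neighborsC.
  by move/set1P=> uy'; move: uy; rewrite uy' (negbTE (notin_neighbors _ _)).
case/negP: xw; rewrite -uc setUC.
by apply: (degree_pred_k simpleE properE k_ge2 freeE dx ux); rewrite // in_neighborsC.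
Qed.

(** The number [m x] of colors missing at [x] is also its number of non-neighbors in the component,
    and is never 1. A deficient [x] has [m x >= 2], and so has each of its [m x] non-neighbors; the
    total [k] is thus at least [3 * m x]. *)
Lemma equality_degree_bound : 4 < k.
Proof.
pose m x := #|[set w in N v | missing x w]|.
have mS x : x \in S -> #|N x| + m x = k by apply: degree_missing_eq.
have m1 x : x \in S -> m x != 1.
  by move=> xS; have := no_degree_pred_k xS; have := mS _ xS; lia.
have [x xS mx] : exists2 x, x \in S & 0 < m x.
  apply/exists_inP; apply: contraT; rewrite negb_exists_in => /forall_inP m0.
  have := missing_sum_eq; rewrite big1 => [|x /m0]; first by lia.
  by rewrite -/(m x); lia.
pose Q := (S :\ x) :\: N x.
have Sx : N x \subset S :\ x.
  by rewrite subsetD1 notin_neighbors // degree_k_component.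
have cS := card_component_D1 xS.
have cQ : #|Q| = m x by rewrite cardsD (setIidPr Sx) cS -(mS _ xS) addKn.
have mQ y : y \in Q -> 2 <= m y.
  rewrite in_setD in_setD1 => /and3P[yNx yx yS].
  have : #|N y| < #|S :\ y|.
    apply: proper_card; rewrite fintype.properE subsetD1 notin_neighbors // degree_k_component //=.
    apply/subsetPn; exists x; first by rewrite in_setD1 eq_sym yx.
    by rewrite in_neighborsC.
  rewrite (card_component_D1 yS).
  by have := mS _ yS; have := m1 _ yS; lia.
have : m x + \sum_(y in Q) m y <= k.
  rewrite -[X in _ <= X]missing_sum_eq (bigD1 x xS) /= leq_add2l.
  rewrite big_mkcond [X in _ <= X]big_mkcond /=; apply: leq_sum => y _.
  case: ifP => //; rewrite in_setD in_setD1 => /and3P[_ yx yS].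
  by rewrite (_ : _ && _ = true) //; apply/andP.
have : \sum_(y in Q) 2 <= \sum_(y in Q) m y by apply: leq_sum.
rewrite sum_nat_const cQ; move: (m1 _ xS) mx; move: (m x) (\sum_(y in Q) m y) => a b.
by lia.
Qed.
End Equality.
End DegreeK.
End UpperBound.

(** * Upper bounds on the rainbow Turán number *)

Lemma rainbow_ex_le (U : finType) (F : {set {set U}}) (n p q : nat) :
  (forall (E : {set {set 'I_n}}) c, simple_graph E -> proper_coloring E c ->
     rainbow_free F E c -> q * (#|E| * 2) <= p * #|'I_n|) ->
  q * (rainbow_ex n F * 2) <= p * n.
Proof.
move=> le_pq; rewrite /rainbow_ex.
elim/big_ind: _ => [|x y lex ley|E /andP[sE /boolp.asboolP[c [pE fE]]]].
- by rewrite mul0n muln0.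
- by case: (leqP x y).
- by rewrite -[n in X in _ <= X]card_ord; apply: le_pq fE.
Qed.

Lemma rainbow_ex_le_max_degree (k n : nat) : 2 <= k ->
  1 * (rainbow_ex n (broom k) * 2) <= k * n.
Proof.
move=> k2; apply: rainbow_ex_le => E c sE pE fE; apply: edge_bound => // v.
rewrite mul1n => kv; apply: (star_component sE pE k2 fE kv).
by move: kv; move: #|_| => d; nia.
Qed.

Lemma rainbow_ex_le_even (k n : nat) : 3 <= k -> ~~ odd k ->
  k.+1 * (rainbow_ex n (broom k) * 2) <= k ^ 2 * n.
Proof.
move=> k3 ek; have k2 : 2 <= k by apply: leq_trans k3.
apply: rainbow_ex_le => E c sE pE fE; apply: edge_bound => // v ltv.
(* As [k.-1 * k.+1 < k ^ 2], a degree above [k ^ 2 / k.+1] is at least [k]. *)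
have : k <= #|neighbors E v| by move: ltv; move: #|_| => d; nia.
rewrite leq_eqVlt => /orP[/eqP/esym dv|kv].
  split; first exact: (degree_k_component sE pE k2 fE dv).
  rewrite card_closed_neighborhood // dv mulnC -mulnn leq_mul2r /=.
  exact: degree_k_sum pE k2 fE _ dv ek.
apply: (star_component sE pE k2 fE kv).
by move: kv; move: #|_| => d; nia.
Qed.

Lemma rainbow_ex_le_4 (n : nat) : 1 * (rainbow_ex n (broom 4) * 2) <= 3 * n.
Proof.
apply: rainbow_ex_le => E c sE pE fE; apply: edge_bound => // v.
rewrite mul1n leq_eqVlt => /orP[/eqP/esym dv|kv].
  split; first exact: (@degree_k_component _ _ _ 4 sE pE isT fE _ dv).
  (* The component has 5 vertices; a degree sum above [3 * 5] would attain [4 * 4], which requires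
     [4 < k]. *)
  rewrite card_closed_neighborhood // dv mul1n -ltnS ltnNge.
  by apply/negP => /(@equality_degree_bound _ _ _ 4 sE pE isT fE _ dv isT).
apply: (star_component sE pE _ fE kv) => //.
by move: kv; move: #|_| => d; nia.
Qed.

(** For [k = 2] the broom is a path with two edges, rainbow in every proper coloring, so all degrees
    are at most 1. *)
Lemma rainbow_ex_le_2 (n : nat) : 1 * (rainbow_ex n (broom 2) * 2) <= 1 * n.
Proof.
apply: rainbow_ex_le => E c sE pE fE; apply: edge_bound => // v.
rewrite mul1n => /card_gt1P[x [z [xv zv xz]]].
by case: (@rainbow_broom_exists _ _ c sE pE 2 z v x); rewrite // in_neighborsC.
Qed.

(** [P] is the degree sum of a copy on [t] vertices, with average [p / q]; the vertices left over
    cost at most [p * t]. *)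
Lemma block_count_bound (p q t P ex n : nat) : 0 < t -> q * P = p * t ->
  n %/ t * P <= ex * 2 -> p * n <= q * (ex * 2) + p * t.
Proof.
move=> t0 qP le_ex; have nt : n <= (n %/ t).+1 * t by rewrite ltnW // ltn_ceil.
apply: leq_trans (leq_mul (leqnn p) nt) _.
rewrite mulSn mulnDr addnC leq_add2r mulnCA -qP mulnCA.
by rewrite leq_mul2l le_ex orbT.
Qed.

(** * From integer bounds to the asymptotic statement *)

Import Order.TTheory GRing.Theory Num.Theory.
Local Open Scope ring_scope.

Lemma bounded_difference (p q K : nat) (f : nat -> nat) : (0 < q)%N ->
  (forall n, (q * (f n * 2) <= p * n)%N) ->
  (forall n, (p * n <= q * (f n * 2) + K)%N) ->
  exists C : rat, forall n, `|(f n)%:R - p%:R / (2 * q%:R) * n%:R| <= C.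
Proof.
move=> q0 le1 le2; exists K%:R => n.
have Q0 : 1 <= q%:R :> rat by rewrite ler1n.
have := le1 n; rewrite -(ler_nat rat) !natrM => {}le1.
have := le2 n; rewrite -(ler_nat rat) natrD !natrM => {}le2.
have K0 : 0 <= K%:R :> rat by [].
have qn0 : 2 * q%:R != 0 :> rat by apply/eqP; lra.
have -> : (f n)%:R - p%:R / (2 * q%:R) * n%:R =
    (q%:R * ((f n)%:R * 2) - p%:R * n%:R) / (2 * q%:R) :> rat.
  by rewrite mulrBl mulrAC; congr (_ - _); rewrite mulrCA [q%:R * 2]mulrC mulfK.
rewrite normrM normfV (ger0_norm (_ : 0 <= 2 * q%:R)); last lra.
rewrite ler_pdivrMr; last lra.
rewrite ler_norml; nra.
Qed.

Theorem theorem2 (k : nat) (hk : (2 <= k)%N) :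
  exists C : rat, forall n : nat,
    `| (rainbow_ex n (broom k))%:R
       - (if odd k then k%:R / 2
          else if (k == 2%N) || (k == 4%N) then (k%:R - 1) / 2
          else k%:R ^+ 2 / (2 * (k%:R + 1))) * n%:R | <= C.
Proof.
case: ifP => [ok|/negbT ek].
  (* The average degree [p / q] is [k] here, then [k - 1], then [k ^ 2 / k.+1]. *)
  have [//|n|n|C HC] := @bounded_difference k 1 (k * k.+1) (fun n => rainbow_ex n (broom k)).
  - exact: rainbow_ex_le_max_degree.
  - by apply: block_count_bound (rainbow_ex_ge_odd n hk ok) => //; rewrite mul1n.
  - by exists C => n; have := HC n; rewrite mulr1.
case: ifP => k24.
  have [//|n|n|C HC] :=
    @bounded_difference (k - 1) 1 ((k - 1) * k) (fun n => rainbow_ex n (broom k)).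
  - by case/orP: k24 => /eqP->; [apply: rainbow_ex_le_2|apply: rainbow_ex_le_4].
  - apply: block_count_bound (rainbow_ex_ge_clique n hk); first exact: ltnW.
    by rewrite mul1n subn1 mulnC.
  - by exists C => n; have := HC n; rewrite mulr1 natrB // ltnW.
have k6 : (6 <= k)%N by move: ek k24 hk; case: (k) => [|[|[|[|[|[|k']]]]]].
have [//|n|n|C HC] :=
  @bounded_difference (k ^ 2) k.+1 (k ^ 2 * k.+1) (fun n => rainbow_ex n (broom k)).
- by apply: rainbow_ex_le_even => //; apply: leq_trans k6.
- by apply: block_count_bound (rainbow_ex_ge_even n k6 ek); rewrite // mulnC.
- by exists C => n; have := HC n; rewrite natrX natr1.
Qed.
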